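(* Let $m\ge2$, let $p_1,\dots,p_m>0$ with $\sum_i p_i=1$ be linearly independent over $\mathbb{Q}$, and let $i\ne j$ be two parties. Suppose that parties $i$ and $j$ form an apparentement, and let $s_{ij}$ be the number of seats they get together as an apparentement. With $N$ uniformly distributed on $\{1,\dots,N_0\}$, the mean of their seat gain $s_{ij}-s_i-s_j$ satisfies, as $N_0\to\infty$, $$\mathbb{E}(s_{ij}-s_i-s_j)\to(\beta-\tfrac12)(1-p_i-p_j)$$ for the $\beta$-linear divisor method ($\beta\in\mathbb{R}$), and $$\mathbb{E}(s_{ij}-s_i-s_j)\to\gamma\Bigl(\frac2m-\frac1{m-1}\Bigr)=\gamma\,\frac{m-2}{m(m-1)}$$ for the $\gamma$-quota method ($\gamma\in\mathbb{R}$).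
   Context: There are $m$ parties; party $k$ has proportion $p_k>0$ of the votes. $N$ (the house size) seats are distributed, and party $k$ gets $s_k=s_k(N)$ seats, $\sum_k s_k=N$. When parties $i$ and $j$ form an apparentement, the $N$ seats are distributed by the same method in an election with $m-1$ participants, in which $i$ and $j$ are replaced by a single participant with proportion of votes $p_i+p_j$, the other parties keeping their proportions $p_k$; $s_{ij}$ is the number of seats of the merged participant. $s_i,s_j$ are the seat numbers in the original election with $m$ separate parties and the same $N$. For real $\alpha,x$, the $\alpha$-rounding $[x]_\alpha$ is an integer $n$ with $x-\alpha\le n\le x-\alpha+1$ (if $x-\alpha\in\mathbb{Z}$, both $x-\alpha$ and $x-\alpha+1$ are accepted values). The $\beta$-linear divisor method for participants with proportions $p_k$: $s_k=\max\{[p_k/D']_\beta,0\}$ where the real number $D'>0$ (and the choices of rounding in case of ties) are such that $\sum_k s_k=N$. The maximum with $0$ only matters if $\beta>1$ and $N$ is small; if $\beta\le 0$ the method with $m$ participants is defined only for $N\ge m(\lfloor|\beta|\rfloor+1)$. The $\gamma$-quota method (for $N+\gamma>0$): $s_k=[(N+\gamma)p_k]_\alpha$ for all $k$, where the real number $\alpha$ (and the choices of rounding in case of ties) are such that $\sum_k s_k=N$. Ties are resolved at random. Finitely many $N$ for which a method is undefined are irrelevant for the limit and may be ignored. *)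

(* Defs.v *)
From HB Require Import structures.
From mathcomp Require Import all_boot all_order all_algebra.
From mathcomp Require Import all_classical all_reals all_analysis.

Set Implicit Arguments.
Unset Strict Implicit.
Unset Printing Implicit Defensive.

Import Order.TTheory GRing.Theory Num.Theory.
Import numFieldNormedType.Exports.

Local Open Scope classical_set_scope.
Local Open Scope ring_scope.

Definition lin_indep_rat (R : realType) (I : finType) (p : I -> R) : Prop :=
  forall c : I -> rat, \sum_k ratr (c k) * p k = 0 -> forall k, c k = 0.

(* [n] is an accepted value of [x]_alpha; there are two accepted values exactly
   when x - alpha is an integer. *)
Definition is_rounding (R : realType) (alpha x : R) (n : int) : Prop :=
  x - alpha <= n%:~R <= x - alpha + 1.

(* An election method is the relation "s is a possible outcome for the house
   size N and the proportions of votes p".  It relates several s to the same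
   (p, N) when there are ties, and none when the method is undefined there. *)
Definition election_method (R : realType) : Type :=
  forall I : finType, (I -> R) -> nat -> (I -> int) -> Prop.

Definition linear_divisor (R : realType) (beta : R) : election_method R :=
  fun I p N s =>
    exists2 D : R, 0 < D &
    exists r : I -> int,
      [/\ forall k, is_rounding beta (p k / D) (r k),
          forall k, s k = Num.max (r k) 0 &
          \sum_k s k = N%:Z].

Definition quota (R : realType) (gamma : R) : election_method R :=
  fun I p N s =>
    0 < N%:R + gamma /\
    exists alpha : R,
      (forall k, is_rounding alpha ((N%:R + gamma) * p k) (s k)) /\
      \sum_k s k = N%:Z.

(* [None] is the apparentement of i and j; [Some k] is a remaining party. *)
Definition merged (I : finType) (i j : I) : finType :=
  option {k : I | (k != i) && (k != j)}.

Definition merged_votes (R : realType) (I : finType) (i j : I) (p : I -> R)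
    (k : merged i j) : R :=
  if k is Some k' then p (val k') else p i + p j.

(* Seat numbers s N : Omega -> I -> int produced by the method M, where the
   sample point resolves the ties, according to an arbitrary law.  The finitely
   many N excepted by [\near] leave room for those where M is undefined; there
   the seat numbers are arbitrary, and integrability makes their means exist
   (for the other N it amounts to measurability, the possible outcomes being
   finite in number). *)
Definition seats_by (R : realType) (M : election_method R)
    (d : measure_display) (Omega : measurableType d) (P : probability Omega R)
    (I : finType) (p : I -> R) (s : nat -> Omega -> I -> int) : Prop :=
  (forall N k, P.-integrable setT (fun w => ((s N w k)%:~R : R)%:E)) /\
  (\forall N \near \oo, forall w, M I p N (s N w)).

Definition seat_gain (R : realType) (Omega : Type) (I : finType) (i j : I)
    (s : nat -> Omega -> I -> int) (t : nat -> Omega -> merged i j -> int)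
    (N : nat) (w : Omega) : R :=
  (t N w None - s N w i - s N w j)%:~R.

(* Mean over the ties and over N uniformly distributed on {1, ..., N0}. *)
Definition mean_gain (R : realType) (d : measure_display)
    (Omega : measurableType d) (P : probability Omega R) (I : finType) (i j : I)
    (s : nat -> Omega -> I -> int) (t : nat -> Omega -> merged i j -> int)
    (N0 : nat) : \bar R :=
  ((N0%:R^-1)%:E * \sum_(1 <= N < N0.+1) 'E_P[seat_gain R s t N])%E.

(* Main.v *)
Require Import Defs.
From HB Require Import structures.
From mathcomp Require Import all_boot all_order all_algebra.
From mathcomp Require Import all_classical all_reals all_analysis.
From mathcomp Require Import ring lra zify.

(** Both methods fit one scheme: the deviations [w k = s k - N * p k] sum to 0
    and satisfy [T * q k + o k <= w k <= T * q k + o k + 1] for some real [T],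
    with [q = p], [o = - beta] for the divisor method and [q = 1],
    [o k = gamma * p k] for the quota method.  This region is stable under the
    reflection [w |-> c - w], where [c = reflection q o], and away from near
    ties [w] depends only, and continuously, on the class of [N * p] modulo 1.
    As [N * p] is equidistributed on the torus (tested against Fejer kernels),
    [w] and [c - w] have the same mean, namely [c / 2]. *)

Set Implicit Arguments.
Unset Strict Implicit.
Unset Printing Implicit Defensive.

Import Order.TTheory GRing.Theory Num.Theory.
Import numFieldNormedType.Exports.

Local Open Scope classical_set_scope.
Local Open Scope ring_scope.

(** The class modulo 1 fixes [w] away from near ties because an integer vector of sum 0 that moves
    [w] inside the region must raise one party and lower another; as each interval has length 1, the
    first was at its bottom and the second at its top for one common [T]. Since [w N] is [- N * p]
    modulo 1, the points [w N] and [c - w M] are thus close once [(N + M) * p + c] is close to an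
    integer vector. Averaging over pairs [(N, M)] with a kernel concentrated there avoids any limit
    measure on the torus and any function defined across the discontinuities at ties. Two obstacles
    remain. The relation [\sum_k p k = 1] destroys equidistribution in all coordinates at once, so
    the kernel omits one coordinate, which the zero sums recover. Near ties must be rare for every
    resolution of ties; this follows from an arithmetic spacing argument on house sizes. All bounds
    hold for each sequence of outcomes separately, so the law of the ties never enters. *)

(** ** Fejer kernels *)

Section Fejer.
Context {R : realType}.
Implicit Types (x y psi : R) (L : nat).

Definition fejer L x : R :=
  ((\sum_(j < L) cos (j%:R * x)) ^+ 2 + (\sum_(j < L) sin (j%:R * x)) ^+ 2)
    / L%:R.

(** The factor [2 * sin (x / 2)] makes the sum telescope. The phase [psi] lets one identity serve
    sine sums too, by a shift of a quarter period. *)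
Lemma sum_cos_arith L x psi :
  2 * sin (x / 2) * \sum_(j < L) cos (j%:R * x + psi) =
  sin (L%:R * x + psi - x / 2) - sin (psi - x / 2).
Proof.
elim: L => [|L IH]; first by rewrite big_ord0 mul0r add0r mulr0 subrr.
rewrite big_ord_recr/= mulrDr {}IH.
have -> : L.+1%:R * x + psi - x / 2 = L%:R * x + psi + x / 2.
  by rewrite -natr1; lra.
by rewrite (sinD _ (x / 2)) (sinB (_ + psi)); ring.
Qed.

Lemma sum_cos_arith_le L x psi :
  `|sin (x / 2) * \sum_(j < L) cos (j%:R * x + psi)| <= 1.
Proof.
have := sum_cos_arith L x psi.
have := sin_le1 (L%:R * x + psi - x / 2).
have := sin_geN1 (L%:R * x + psi - x / 2).
have := sin_le1 (psi - x / 2); have := sin_geN1 (psi - x / 2).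
by rewrite ler_norml -mulrA => *; apply/andP; split; lra.
Qed.

Lemma sum_sin_arith_le L x :
  `|sin (x / 2) * \sum_(j < L) sin (j%:R * x)| <= 1.
Proof.
under eq_bigr do rewrite -cosBpihalf.
exact: sum_cos_arith_le.
Qed.

Lemma fejer_ge0 L x : 0 <= fejer L x.
Proof. by rewrite divr_ge0// addr_ge0// sqr_ge0. Qed.

(** The cosine and the sine sum each contribute at most 1, hence the 2. This is the decay of the
    kernel away from multiples of [2 * pi]. *)
Lemma fejer_le L x : sin (x / 2) ^+ 2 * fejer L x <= 2 / L%:R.
Proof.
rewrite /fejer mulrA ler_wpM2r ?invr_ge0//.
rewrite mulrDr -!exprMn -[leRHS]/(1 + 1).
have sq1 (z : R) : `|z| <= 1 -> z ^+ 2 <= 1.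
  by move=> z1; rewrite -real_normK ?num_real// expr_le1.
rewrite lerD// sq1 ?sum_sin_arith_le//.
under eq_bigr do rewrite -[_ * x]addr0.
exact: sum_cos_arith_le.
Qed.

(** Spreading the frequency over the shifts [j - l] costs no sine term: the coefficient of [sin y]
    is antisymmetric in [j] and [l]. *)
Lemma cosM_fejer L x y :
  cos y * fejer L x =
  L%:R^-1 * \sum_(j < L) \sum_(l < L) cos (y + (j%:R - l%:R) * x).
Proof.
rewrite /fejer mulrA mulrC; congr (_ * _).
pose C := \sum_(j < L) cos (j%:R * x); pose S := \sum_(j < L) sin (j%:R * x).
transitivity (\sum_(j < L) (cos y * (cos (j%:R * x) * C + sin (j%:R * x) * S)
   - sin y * (sin (j%:R * x) * C - cos (j%:R * x) * S))); last first.
  apply: eq_bigr => j _; rewrite /C /S !mulr_sumr -big_split -sumrB/=.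
  rewrite !mulr_sumr -sumrB; apply: eq_bigr => l _.
  by rewrite cosD mulrBl cosB sinB; ring.
rewrite sumrB -!mulr_sumr big_split sumrB -!mulr_suml/= -/C -/S; ring.
Qed.

Lemma norm_sin_piDz x (z : int) :
  `|sin (pi * (x + z%:~R))| = `|sin (pi * x)|.
Proof.
have piDn y (n : nat) : `|sin (pi * (y + n%:R))| = `|sin (pi * y)|.
  elim: n y => [|n IH] y; first by rewrite addr0.
  by rewrite -natr1 addrA mulrDr mulr1 sinDpi normrN IH.
case: z => n; first exact: piDn.
by rewrite NegzE mulrNz -(piDn (x - _) n.+1) subrK.
Qed.

(** By compactness [sin (pi * y)] has a positive minimum on [[d, 1 - d]], and its absolute value has
    period 1. Capping [d] at 1/2 keeps this interval nonempty. *)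
Lemma sin_pi_near_int (e : R) : 0 < e ->
  exists2 eta : R, 0 < eta & forall x, `|sin (pi * x)| < eta ->
    exists z : int, `|x - z%:~R| < e.
Proof.
move=> e0; pose d := Num.min e 2^-1.
have d0 : 0 < d by rewrite lt_min e0/=; lra.
have de : d <= e by rewrite ge_min lexx.
have d2 : d <= 2^-1 by rewrite ge_min lexx orbT.
have [|c /[!in_itv]/= /andP[c1 c2] cmin] :=
    @EVT_min R (fun y => sin (pi * y)) d (1 - d) ltac:(lra).
  apply: continuous_subspaceT => y.
  apply: continuous_comp; last exact: continuous_sin.
  exact: mulrl_continuous.
exists (sin (pi * c)).
  apply: sin_gt0_pi; rewrite mulr_gt0 ?pi_gt0 ?gtr_pMr ?pi_gt0//=; lra.
move=> x; have /andP[x0 x1] := floor_itv x.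
set f := Num.floor x in x0 x1 *.
rewrite -{1}[x](subrK f%:~R) norm_sin_piDz.
rewrite intrD in x1.
have [xd _|dx] := ltP (x - f%:~R) d.
  by exists f; rewrite ger0_norm ?subr_ge0//; exact: lt_le_trans de.
have [xd|dx' _] := leP (x - f%:~R) (1 - d).
  move=> /(le_lt_trans (ler_norm _)); rewrite ltNge cmin//.
  by rewrite in_itv/= dx xd.
by exists (f + 1); rewrite intrD ltr_norml; apply/andP; split; lra.
Qed.

Lemma sin_pi_neq0 x : (forall z : int, x != z%:~R) -> sin (pi * x) != 0.
Proof.
move=> xz; have /andP[x0 x1] := floor_itv x.
rewrite -normr_eq0 -[x](subrK (Num.floor x)%:~R) norm_sin_piDz normr_eq0.
rewrite intrD in x1.
rewrite gt_eqF// sin_gt0_pi// mulr_gt0 ?pi_gt0 ?gtr_pMr ?pi_gt0//=.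
  by lra.
by rewrite subr_gt0 lt_neqAle x0 eq_sym xz.
Qed.

Lemma sum_cos_bounded (al : R) : (forall z : int, al != z%:~R) ->
  exists C : R, forall psi (X : nat),
    `|\sum_(M < X) cos (M%:R * (2 * pi * al) + psi)| <= C.
Proof.
move=> /sin_pi_neq0 s0; exists `|sin (pi * al)|^-1 => psi X.
have := sum_cos_arith_le X (2 * pi * al) psi.
have -> : 2 * pi * al / 2 = pi * al by lra.
by rewrite normrM -ler_pdivlMl ?normr_gt0// mulr1.
Qed.

End Fejer.

(** * Means of products of Fejer kernels along an orbit *)

Section FejerMean.
Context {R : realType} (I : finType) (k : I) (theta : I -> R).
Hypothesis theta_indep : forall (c : I -> int) (z : int),
  c k = 0 -> \sum_a (c a)%:~R * theta a = z%:~R -> forall a, c a = 0.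
Variable (L : nat).
Hypothesis L_gt0 : (0 < L)%N.

(** The cosine factor is there for the induction on [s]: expanding the kernel at [a] turns the
    frequency vector [c] into [c] plus [j - l] at [a]. Nonzero frequencies give bounded sums by
    independence. The bound is uniform in [psi] and [t], so it can serve all rows of a double
    sum. *)
Lemma cos_fejer_sum (s : seq I) (c : I -> int) : uniq s -> k \notin s ->
  c k = 0 -> {in s, forall a, c a = 0} ->
  exists C : R, forall psi (t : I -> R) (X : nat),
    `|\sum_(M < X) cos (M%:R * (2 * pi * \sum_a (c a)%:~R * theta a) + psi) *
        \prod_(a <- s) fejer L (M%:R * (2 * pi * theta a) + t a) -
      (if [forall a, c a == 0] then X%:R * cos psi else 0)| <= C.
Proof.
elim: s c => [|a s IH] c /=.
  move=> _ _ ck _; have [/forallP c0|] := boolP [forall a, c a == 0].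
    have al0 : \sum_a (c a)%:~R * theta a = 0.
      by rewrite big1 // => b _; rewrite (eqP (c0 b)) mul0r.
    exists 0 => psi t X; rewrite al0 mulr0.
    under eq_bigr do rewrite mulr0 add0r big_nil mulr1.
    by rewrite sumr_const card_ord mulr_natl subrr normr0.
  rewrite negb_forall => /existsP[b cb].
  have [|C HC] := sum_cos_bounded (al := \sum_a (c a)%:~R * theta a).
    move=> z; apply/eqP => /theta_indep => /(_ ck b) cb0.
    by rewrite cb0 eqxx in cb.
  exists C => psi t X; rewrite subr0.
  under [X in `|X|]eq_bigr do rewrite big_nil mulr1.
  exact: HC.
move=> /andP[as_ us]; rewrite inE negb_or => /andP[ka ks] ck cs.
pose cc (jl : 'I_L * 'I_L) b : int :=
  c b + (jl.1%:Z - jl.2%:Z) * (b == a)%:R.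
have ccs jl : {in s, forall b, cc jl b = 0}.
  move=> b bs; rewrite /cc cs ?inE ?bs ?orbT//.
  have /negPf-> : b != a by apply: contraNneq as_ => <-.
  by rewrite mulr0.
have cck jl : cc jl k = 0 by rewrite /cc ck (negPf ka) mulr0.
have /choice[C HC] := fun jl => IH (cc jl) us ks (cck jl) (ccs jl).
exists (L%:R^-1 * \sum_j \sum_l C (j, l)) => psi t X.
have ccE jl : \sum_b (cc jl b)%:~R * theta b =
    \sum_b (c b)%:~R * theta b + (jl.1%:R - jl.2%:R) * theta a.
  rewrite /cc; under [LHS]eq_bigr do rewrite intrD mulrDl.
  rewrite big_split/=; congr (_ + _).
  rewrite (bigD1 a)//= eqxx mulr1 big1 ?addr0 ?intrD ?mulrNz// => b /negPf->.
  by rewrite mulr0 mul0r.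
have -> : (if [forall a, c a == 0] then X%:R * cos psi else 0) =
    L%:R^-1 * \sum_(j < L) \sum_(l < L)
     (if [forall b, cc (j, l) b == 0]
      then X%:R * cos (psi + (j%:R - l%:R) * t a) else 0).
  have ca : c a = 0 by rewrite cs ?mem_head.
  have ccj (j l : 'I_L) : [forall b, cc (j, l) b == 0] =
      [forall b, c b == 0] && (j == l).
    apply/forallP/andP => [h|[/forallP h /eqP->] b]; last first.
      by rewrite /cc/= subrr mul0r addr0.
    have jl : j = l.
      apply/val_inj; have := h a; rewrite /cc/= ca eqxx mulr1 add0r subr_eq0.
      by move=> /eqP[].
    split; last exact/eqP.
    by apply/forallP => b; have := h b; rewrite /cc/= jl subrr mul0r addr0.
  (* As [c a = 0], a shifted frequency vanishes only if [c = 0] and [j = l]; the [L] diagonal pairs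
     then compensate the factor [L%:R^-1]. *)
  transitivity (L%:R^-1 * \sum_(j < L)
     (if [forall b, c b == 0] then X%:R * cos psi else 0)).
    rewrite sumr_const card_ord -[X in _ = _ * X]mulr_natl mulKf//.
    by rewrite pnatr_eq0 -lt0n.
  congr (_ * _); apply: eq_bigr => j _.
  rewrite (bigD1 j)//= ccj eqxx andbT subrr mul0r addr0 big1 ?addr0// => l lj.
  by rewrite ccj eq_sym (negPf lj) andbF.
have -> : \sum_(M < X)
      cos (M%:R * (2 * pi * \sum_a (c a)%:~R * theta a) + psi) *
      \prod_(b <- a :: s) fejer L (M%:R * (2 * pi * theta b) + t b) =
    L%:R^-1 * \sum_(j < L) \sum_(l < L) \sum_(M < X)
      cos (M%:R * (2 * pi * \sum_b (cc (j, l) b)%:~R * theta b) +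
           (psi + (j%:R - l%:R) * t a)) *
      \prod_(b <- s) fejer L (M%:R * (2 * pi * theta b) + t b).
  under eq_bigr do rewrite big_cons mulrA cosM_fejer -[L%:R^-1 * _ * _]mulrA.
  rewrite -mulr_sumr; congr (_ * _).
  under eq_bigr do rewrite mulr_suml.
  rewrite exchange_big; apply: eq_bigr => j _.
  under eq_bigr do rewrite mulr_suml.
  rewrite exchange_big; apply: eq_bigr => l _.
  apply: eq_bigr => M _; congr (cos _ * _).
  by rewrite ccE/=; ring.
rewrite -mulrBr normrM ger0_norm ?invr_ge0// ler_wpM2l ?invr_ge0//.
rewrite -sumrB; apply: le_trans (ler_norm_sum _ _ _) _; apply: ler_sum => j _.
rewrite -sumrB; apply: le_trans (ler_norm_sum _ _ _) _; apply: ler_sum => l _.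
exact: HC.
Qed.

Lemma fejer_mean (s : seq I) : uniq s -> k \notin s ->
  exists C : R, forall (t : I -> R) (X : nat),
    `|\sum_(M < X) \prod_(a <- s) fejer L (M%:R * (2 * pi * theta a) + t a)
      - X%:R| <= C.
Proof.
move=> us ks.
have [//|C HC] := @cos_fejer_sum s (fun=> 0) us ks erefl.
have al0 : \sum_a (0 : int)%:~R * theta a = 0.
  by rewrite big1// => a _; rewrite mul0r.
exists C => t X; have /= := HC 0 t X.
have -> : [forall a : I, (0 : int) == 0] by apply/forallP.
rewrite al0 cos0 mulr1 mulr0.
by under eq_bigr do rewrite mulr0 addr0 cos0 mul1r.
Qed.

End FejerMean.

(** ** The strip and its reflection *)

Section Strip.
Context {R : realType} (I : finType) (q o : I -> R).
Hypothesis q_gt0 : forall k, 0 < q k.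

Definition in_strip (w : I -> R) :=
  exists T : R, forall k, T * q k + o k <= w k <= T * q k + o k + 1.

(** Intervals [[T * q k + o k, T * q k + o k + 1]] reflect to intervals of the same family when the
    centre is [2 * o k + 1] plus a common multiple of [q k]; this multiple makes the coordinates sum
    to 0. *)
Definition reflection (k : I) : R :=
  2 * o k + 1 - (2 * (\sum_a o a) + #|I|%:R) / (\sum_a q a) * q k.

Lemma sum_slope_gt0 (k : I) : 0 < \sum_a q a.
Proof.
by rewrite (bigD1 k)//= ltr_pwDl// sumr_ge0// => a _; exact: ltW.
Qed.

Lemma sum_reflection (k : I) : \sum_a reflection a = 0.
Proof.
rewrite /reflection sumrB big_split/= -!mulr_sumr sumr_const -/#|I|.
by rewrite divfK ?subrr// gt_eqF// sum_slope_gt0.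
Qed.

Lemma reflect_in_strip w :
  in_strip w -> in_strip (fun k => reflection k - w k).
Proof.
move=> [T HT]; rewrite /reflection; set S := _ / _.
by exists (- S - T) => k; have /andP[? ?] := HT k; apply/andP; split; lra.
Qed.

(** Summing the strip inequalities over the parties confines [T * Q] to [[- O - n, O]], which bounds
    each [T * q k]. *)
Lemma in_strip_bounded : exists B : R, forall w, in_strip w ->
  \sum_a w a = 0 -> forall k, `|w k| <= B.
Proof.
pose Q := \sum_a q a; pose O := \sum_a `|o a|; pose n : R := #|I|%:R.
exists (O + n + O + 1) => w [T HT] w0 k.
have Q0 : 0 < Q := sum_slope_gt0 k.
have n0 : 0 <= n by rewrite ler0n.
have O0 a : `|o a| <= O by rewrite /O (bigD1 a)//= lerDl sumr_ge0.
have /andP[OO1 OO2] : - O <= \sum_a o a <= O by rewrite -ler_norml ler_norm_sum.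
have qk : q k <= Q.
  by rewrite /Q (bigD1 k)//= lerDl sumr_ge0// => a _; exact: ltW.
have lo : T * Q + \sum_a o a <= 0.
  rewrite -[leRHS]w0 /Q mulr_sumr -big_split/=; apply: ler_sum => a _.
  by have /andP[] := HT a.
have hi : 0 <= T * Q + \sum_a o a + n.
  rewrite -[leLHS]w0 /Q /n -[X in _ + X]sumr_const mulr_sumr -!big_split/=.
  by apply: ler_sum => a _; have /andP[] := HT a.
have Tq : `|T * q k| <= O + n.
  apply: (@le_trans _ _ `|T * Q|); last first.
    by rewrite ler_norml; apply/andP; split; lra.
  by rewrite !normrM ler_wpM2l// !gtr0_norm.
move: Tq (O0 k); rewrite !ler_norml => /andP[? ?] /andP[? ?].
by have /andP[? ?] := HT k; apply/andP; split; lra.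
Qed.

Lemma sum0_signs (z : I -> int) : \sum_a z a = 0 ->
  (forall a, z a = 0) \/ exists a b, 0 < z a /\ z b < 0.
Proof.
have nonneg (y : I -> int) : \sum_a y a = 0 ->
    (forall a, y a = 0) \/ exists a, y a < 0.
  move=> y0; case: (boolP [exists a, y a < 0]) => [/existsP|]; first by right.
  rewrite negb_exists => /forallP yge; left => a.
  by apply/(psumr_eq0P _ y0) => // {}a _; rewrite leNgt.
move=> z0; have [|[b zb]] := nonneg _ z0; first by left.
have [|h|[a za]] := nonneg (fun a => - z a); first by rewrite sumrN z0 oppr0.
  by move: zb; rewrite -[z b]opprK h oppr0 ltxx.
by right; exists a, b; rewrite -oppr_lt0.
Qed.

(* Vanishes when, for a common [T], [w a] is at the bottom of its interval and
   [w b] at the top of its own: party [a] is about to get a seat that [b] has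
   just got. *)
Definition tie_gap (w : I -> R) (a b : I) : R :=
  q b * (w a - o a) - q a * (w b - o b - 1).

(** If [z] is not 0, some [a] gains and some [b] loses about one whole seat between [w] and [w'].
    Then [w a] exceeds its lower end by at most [(T' - T) * q a + e] and [w b] misses its upper end
    by at most [e - (T' - T) * q b]. Weighting by [q b] and [q a] eliminates [T' - T] and bounds
    [tie_gap]. *)
Lemma in_strip_rigid (w w' : I -> R) (z : I -> int) (e : R) :
  in_strip w -> in_strip w' -> \sum_a w a = \sum_a w' a ->
  (forall a, `|w' a - w a - (z a)%:~R| <= e) -> #|I|%:R * e < 1 ->
  (forall a, z a = 0) \/
  exists a b, a != b /\ `|tie_gap w a b| <= 2 * e * (\sum_k q k).
Proof.
move=> [T HT] [T' HT'] ww' we e1.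
(* The total rounding error is below 1, and an integer of absolute value below 1 is 0. *)
have z0 : \sum_a z a = 0.
  have : `|\sum_a (w' a - w a - (z a)%:~R)| < 1.
    apply: le_lt_trans (ler_norm_sum _ _ _) _; apply: le_lt_trans e1.
    by rewrite mulr_natl -sumr_const ler_sum.
  rewrite !sumrB ww' subrr add0r normrN -raddf_sum.
  set y := \sum_a z a; rewrite -intr_norm ltrz1; lia.
have [|[a [b [za zb]]]] := sum0_signs z0; [by left|right].
have ab : a != b by apply: contraTneq za => ->; rewrite -leNgt ltW.
exists a, b; split=> //.
have /andP[wa1 wa2] := HT a; have /andP[wb1 wb2] := HT b.
have /andP[wa1' wa2'] := HT' a; have /andP[wb1' wb2'] := HT' b.
have za1 : 1 <= (z a)%:~R :> R by rewrite ler1z; clear -za; lia.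
have zb1 : (z b)%:~R <= -1 :> R.
  by rewrite -[-1]/((-1)%:~R) ler_int; clear -zb; lia.
have := we a; have := we b; rewrite !ler_norml => /andP[eb1 eb2] /andP[ea1 ea2].
have qa := q_gt0 a; have qb := q_gt0 b.
have qab : q a + q b <= \sum_k q k.
  rewrite (bigD1 a)//= (bigD1 b)/= 1?eq_sym// lerD2l lerDl.
  by rewrite sumr_ge0// => k _; exact: ltW.
have e0 : 0 <= e by clear -eb1 eb2; lra.
have hb : (T' - T) * q b <= e by clear -wb2 wb1' zb1 eb2; lra.
have ha : - e <= (T' - T) * q a by clear -wa1 wa2' za1 ea1; lra.
have ua : w a - T * q a - o a <= (T' - T) * q a + e.
  by clear -wa2' za1 ea1; lra.
have ub : T * q b + o b + 1 - w b <= e - (T' - T) * q b.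
  by clear -wb1' zb1 eb2; lra.
have hba := ler_wpM2l (ltW qa) hb; have hab := ler_wpM2l (ltW qb) ha.
have uab := ler_wpM2l (ltW qb) ua; have uba := ler_wpM2l (ltW qa) ub.
have la : 0 <= q b * (w a - T * q a - o a).
  by apply: mulr_ge0; [exact: ltW|clear -wa1; lra].
have lb : 0 <= q a * (T * q b + o b + 1 - w b).
  by apply: mulr_ge0; [exact: ltW|clear -wb2; lra].
have eq := ler_wpM2l e0 qab.
rewrite /tie_gap; clear -hba hab uab uba la lb eq e0 qa qb.
by apply/andP; split; lra.
Qed.

End Strip.

(** * Counting integers that come in short, widely separated clusters *)

Section Sparse.

(** Moving the start to the first member of [B] in the window leaves only members less than [H0]
    beyond it. *)
Lemma sparse_window (B : pred nat) (H0 H len u : nat) : (len <= H)%N ->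
  (forall N N', (N < N')%N -> B N -> B N' ->
    (N' - N < H)%N -> (N' - N < H0)%N) ->
  (0 < H0)%N ->
  (\sum_(u <= N < u + len) B N <= H0)%N.
Proof.
move=> lenH gap H0_gt0; elim: len u lenH => [|len IH] u lenH.
  by rewrite addn0 big_geq.
case: (boolP (B u)) => [Bu|/negPf Bu]; last first.
  have uu : (u < u + len.+1)%N by rewrite -ltn_subLR ?subnn.
  by rewrite big_ltn// Bu add0n -addSnnS IH// ltnW.
apply: (@leq_trans (\sum_(u <= N < u + len.+1) (N - u < H0))).
  rewrite 2!big_nat; apply: leq_sum => N /andP[uN Nu].
  case: (boolP (B N)) => //= BN.
  have -> //: (N - u < H0)%N.
  move: uN; rewrite leq_eqVlt => /orP[/eqP <-|uN]; first by rewrite subnn.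
  by apply: gap => //; lia.
rewrite -{1}[u]add0n big_addn addKn.
under eq_bigr do rewrite addnK.
apply: leq_trans (_ : (\sum_(0 <= N < len.+1 + H0) (N < H0) <= _)%N).
  by rewrite [leqRHS](@big_cat_nat _ _ _ len.+1)/= ?leq_addr// leq_addr.
rewrite (@big_cat_nat _ _ _ H0)/= ?leq_addl//.
rewrite [X in (_ + X)%N]big1_seq => [|N]; last first.
  by rewrite mem_index_iota /= => /andP[HN _]; rewrite ltnNge HN.
rewrite addn0 -[leqRHS]muln1 -[H0 in leqRHS]subn0 -sum_nat_const_nat.
by apply: leq_sum => N _; exact: leq_b1.
Qed.

Lemma sparse_count (B : pred nat) (H0 H X : nat) : (0 < H)%N -> (0 < H0)%N ->
  (forall N N', (N < N')%N -> B N -> B N' ->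
    (N' - N < H)%N -> (N' - N < H0)%N) ->
  (\sum_(N < X) B N <= (X %/ H).+1 * H0)%N.
Proof.
move=> H_gt0 H0_gt0 gap; rewrite -(big_mkord xpredT (fun N => B N : nat)).
apply: (@leq_trans (\sum_(0 <= N < (X %/ H).+1 * H) B N)).
  rewrite [leqRHS](@big_cat_nat _ _ _ X)/= ?leq_addr//.
  by rewrite ltnW// mulSn addnC {1}(divn_eq X H) ltn_add2l ltn_mod.
elim: (X %/ H).+1 => [|n IH]; first by rewrite mul0n big_geq.
rewrite (@big_cat_nat _ _ _ (n * H))/= ?leq_mul//.
rewrite mulSn [leqRHS]mulSn addnC [(H + _)%N]addnC leq_add//.
exact: sparse_window gap _.
Qed.

Lemma finite_gap (R : realType) (J : finType) (f : J -> R) :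
  exists2 eta : R, 0 < eta & forall j, `|f j| <= eta -> f j = 0.
Proof.
suff [eta eta0 h] : exists2 eta : R, 0 < eta &
    {in enum J, forall j, `|f j| <= eta -> f j = 0}.
  by exists eta => // j; apply: h; rewrite mem_enum.
elim: (enum J) => [|j s [eta eta0 IH]]; first by exists 1.
have [fj|fj] := eqVneq (f j) 0.
  by exists eta => // l; rewrite inE => /predU1P[->|/IH].
have fj0 : 0 < `|f j| / 2 by rewrite divr_gt0 ?normr_gt0.
exists (Num.min eta (`|f j| / 2)); first by rewrite lt_min eta0.
move=> l; rewrite inE le_min => /predU1P[->|/IH h] /andP[h1 h2]; last exact: h.
by lra.
Qed.

End Sparse.

(** * Mean deviation by reflection *)

Section Reflection.
Context {R : realType} (I : finType) (p q o : I -> R).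
Hypothesis p_gt0 : forall k, 0 < p k.
Hypothesis p_sum1 : \sum_k p k = 1.
Hypothesis p_indep : forall (c : I -> int) (z : int),
  \sum_a (c a)%:~R * p a = z%:~R -> forall a, c a = z.
Hypothesis q_gt0 : forall k, 0 < q k.
(* [tie_gap] takes the same value at two house sizes differing by [h] only if
   [a] has as many seats at both, which bounds [h]. *)
Hypothesis no_ties : forall a b (y z : int) (h : nat), a != b -> (0 < h)%N ->
  q b * (y%:~R - h%:R * p a) = q a * (z%:~R - h%:R * p b) -> y = 0.

Definition near_tie (eta : R) (w : I -> R) : bool :=
  [exists a, exists b, (a != b) && (`|tie_gap q o w a b| <= eta)].

(* At two house sizes at most [H] apart, [tie_gap] differs by one of finitely
   many values, hence near ties that are not close together are far apart. *)
Lemma near_tie_sparse (B e : R) : 0 < e ->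
  exists2 eta : R, 0 < eta & exists X0 : nat,
  forall (X : nat) (N1 : nat) (s : nat -> I -> int)
    (w := fun N a => (s N a)%:~R - (N + N1)%:R * p a),
    (X0 <= X)%N -> (forall N a, `|w N a| <= B) ->
    (\sum_(N < X) near_tie eta (w N))%:R <= e * X%:R.
Proof.
move=> e0.
have p1 a : p a <= 1.
  by rewrite -p_sum1 (bigD1 a)//= lerDl sumr_ge0// => b _; exact: ltW.
(* If [a] has as many seats at two house sizes [h] apart, then [h * p a] is a difference of two
   deviations, at most [2 * |B|]; so [h < H0]. *)
pose H0 := (Num.bound (\sum_a 2 * `|B| / p a)).+1.
have H0P a : 2 * `|B| < H0%:R * p a.
  rewrite -ltr_pdivrMr//.
  apply: (@lt_trans _ _ (Num.bound (\sum_a 2 * `|B| / p a))%:R);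
    last by rewrite ltr_nat.
  apply: le_lt_trans (archi_boundP _); last first.
    by apply: sumr_ge0 => b _; rewrite divr_ge0 ?mulr_ge0// ltW.
  rewrite (bigD1 a)//= lerDl.
  by apply: sumr_ge0 => b _; rewrite divr_ge0 ?mulr_ge0// ltW.
pose A := (#|I| * #|I| * H0)%N.
(* Each window of length [H] holds at most [A] bad sizes over all pairs of parties; [H] makes their
   density at most [e / 2]. *)
pose H := (Num.bound (e^-1 * (A%:R * 2))).+1.
have HP (X : nat) : (H.-1 <= X)%N -> A%:R <= e / 2 * X%:R.
  move=> HX; rewrite mulrAC ler_pdivlMr// mulrC -ler_pdivrMl// mulrC.
  apply: (@le_trans _ _ H.-1%:R); last by rewrite ler_nat.
  by rewrite /H/= ltW// archi_boundP// !mulr_ge0// invr_ge0 ltW.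
pose K := Num.bound (2 * `|B| + H%:R).
have KP : 2 * `|B| + H%:R < K%:R.
  by apply: archi_boundP; rewrite addr_ge0 ?mulr_ge0.
(* All possible changes of [tie_gap] over fewer than [H] steps; [u - K] and [v - K] encode the seat
   changes, of absolute value at most [K]. *)
pose f (j : (I * I) * ('I_(K + K).+1 * 'I_(K + K).+1) * 'I_H) : R :=
  let: (a, b, (u, v), h) := j in
  q b * ((u%:R - K%:R) - h%:R * p a) - q a * ((v%:R - K%:R) - h%:R * p b).
have [eta eta0 etaP] := finite_gap f.
exists (eta / 2); first by rewrite divr_gt0.
exists H.-1 => X N1 s w HX wB.
pose bad a b N := (a != b) && (`|tie_gap q o (w N) a b| <= eta / 2).
apply: (@le_trans _ _ (\sum_a \sum_b \sum_(N < X) bad a b N)%:R).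
  rewrite ler_nat.
  under [leqRHS]eq_bigr do rewrite exchange_big.
  rewrite exchange_big; apply: leq_sum => N _.
  have [|//] := boolP (near_tie _ _) => /existsP[a /existsP[b ab]].
  by rewrite (bigD1 a)//= (bigD1 b)//= /bad ab.
have gap a b (N N' : nat) : (N < N')%N -> bad a b N -> bad a b N' ->
    (N' - N < H)%N -> (N' - N < H0)%N.
  move=> NN' /andP[ab bN] /andP[_ bN'] hH.
  pose h := (N' - N)%N.
  pose dz c : int := s N' c - s N c.
  have dw c : w N' c - w N c = (dz c)%:~R - h%:R * p c.
    by rewrite /w /dz /h intrD mulrNz natrB ?(ltnW NN')// !natrD; ring.
  have dzK c : (`|dz c| <= K)%N.
    have : `|(dz c)%:~R : R| < K%:R.
      have -> : (dz c)%:~R = w N' c - w N c + h%:R * p c by rewrite dw; ring.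
      apply: le_lt_trans KP; apply: le_trans (ler_normD _ _) _; apply: lerD.
        rewrite (le_trans (ler_normB _ _))// mulr2n mulrDl mul1r lerD//.
          by rewrite (le_trans (wB _ _))// ler_norm.
        by rewrite (le_trans (wB _ _))// ler_norm.
      rewrite normrM normr_nat gtr0_norm//.
      by rewrite (le_trans (ler_piMr _ (p1 c)))// ler_nat ltnW.
    rewrite -intr_norm -[K%:R]/(K%:Z%:~R) ltr_int => /ltW; lia.
  have ord c : {u : 'I_(K + K).+1 | (u%:R - K%:R : R) = (dz c)%:~R}.
    have := dzK c => dzKc.
    have uK : (`|(dz c + K%:Z)%R|%N < (K + K).+1)%N by lia.
    exists (Ordinal uK) => /=.
    have -> : (`|(dz c + K%:Z)%R|%N%:R : R) = (dz c + K%:Z)%:~R.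
      rewrite -[LHS]/((`|(dz c + K%:Z)%R|%N : int)%:~R); congr (_%:~R); lia.
    by rewrite intrD addrK.
  have [[u uP] [v vP]] := (ord a, ord b).
  have := etaP ((a, b, (u, v)), Ordinal hH).
  rewrite /f/= uP vP -/h.
  have -> : q b * ((dz a)%:~R - h%:R * p a) - q a * ((dz b)%:~R - h%:R * p b) =
      tie_gap q o (w N') a b - tie_gap q o (w N) a b.
    by rewrite -!dw /tie_gap; ring.
  move=> tie; have {}tie : tie_gap q o (w N') a b - tie_gap q o (w N) a b = 0.
    by apply: tie; rewrite (le_trans (ler_normB _ _))// [leRHS]splitr lerD.
  have dza0 : dz a = 0.
    apply: (@no_ties a b (dz a) (dz b) h) => //; first by rewrite subn_gt0.
    apply/eqP; rewrite -subr_eq0 -!dw -tie /tie_gap; apply/eqP; ring.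
  have hp : h%:R * p a <= 2 * `|B|.
    have -> : h%:R * p a = w N a - w N' a.
      by apply/eqP; rewrite -[_ - _]opprB dw dza0 opprB subr0.
    rewrite (le_trans (ler_norm _))// (le_trans (ler_normB _ _))//.
    rewrite mulr2n mulrDl mul1r lerD//.
      by rewrite (le_trans (wB _ _))// ler_norm.
    by rewrite (le_trans (wB _ _))// ler_norm.
  by have := le_lt_trans hp (H0P a); rewrite ltr_pM2r// ltr_nat.
apply: (@le_trans _ _ (A * (X %/ H).+1)%:R).
  rewrite ler_nat.
  apply: (@leq_trans (\sum_(a : I) \sum_(b : I) ((X %/ H).+1 * H0))%N).
    apply: leq_sum => a _; apply: leq_sum => b _.
    exact: sparse_count (gap a b).
  by rewrite !sum_nat_const mulnA [(_.+1 * _)%N]mulnC mulnA.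
rewrite mulnS natrD natrM [e]splitr mulrDl lerD ?HP//.
apply: (@le_trans _ _ (e / 2 * H%:R * (X %/ H)%:R)).
  by rewrite ler_wpM2r// HP// leq_pred.
rewrite -mulrA ler_wpM2l ?divr_ge0// ?(ltW e0)//.
by rewrite -natrM ler_nat mulnC leq_trunc_div.
Qed.


(** The point [reflection - w'] lies in the strip and differs from [w] by nearly an integer vector,
    so rigidity applies to this pair. Nothing is assumed on coordinate [k], which the zero sums
    determine. *)
Lemma reflection_close (k : I) (e eta : R) : 0 < e -> 0 < eta ->
  exists2 eta1 : R, 0 < eta1 & forall (w w' x : I -> R),
    in_strip q o w -> in_strip q o w' -> \sum_a w a = 0 -> \sum_a w' a = 0 ->
    (forall a, exists z : int, reflection q o a - w a - w' a = x a - z%:~R) ->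
    (forall a, a != k -> `|sin (pi * x a)| < eta1) ->
    near_tie eta w \/ `|w k + w' k - reflection q o k| <= e.
Proof.
move=> e0 eta0; pose n : R := #|I|%:R; pose Q := \sum_a q a.
have Q0 : 0 < Q := sum_slope_gt0 q_gt0 k.
have n0 : 1 <= n by rewrite ler1n; apply/card_gt0P; exists k.
have n_gt0 : 0 < n by lra.
(* The three bounds serve the conclusion at [k], the tie threshold and the condition [n * d < 1] of
   rigidity. The other coordinates get [d / n] because their errors add up at [k]. *)
pose d := Num.min e (Num.min (eta / (2 * Q)) (2 * n)^-1).
have d0 : 0 < d by rewrite !lt_min e0 divr_gt0 ?invr_gt0 ?mulr_gt0.
have dn0 : 0 < d / n by rewrite divr_gt0.
have dE : d <= e by rewrite !ge_min lexx.
have dQ : 2 * d * Q <= eta.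
  by rewrite mulrAC -ler_pdivlMl ?mulr_gt0// mulrC !ge_min lexx !orbT.
have dn : n * d < 1.
  apply: (@le_lt_trans _ _ 2^-1); last by lra.
  by rewrite -ler_pdivlMl// mulrC -invfM !ge_min lexx !orbT.
have [eta1 eta10 near] := sin_pi_near_int dn0.
exists eta1 => // w w' x sw sw' w0 w'0 /choice[z xz] xk.
have /choice[y yP] : forall a, exists y : int, a != k -> `|x a - y%:~R| < d / n.
  move=> a; have [_|ak] := eqVneq a k; first by exists 0.
  by have [y ?] := near _ (xk a ak); exists y.
pose v a := reflection q o a - w' a.
pose u a : int := if a == k then - \sum_(b | b != k) (y b - z b) else y a - z a.
have vw a : a != k -> `|v a - w a - (u a)%:~R| < d / n.
  move=> ak; rewrite /u (negPf ak) intrD mulrNz.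
  have -> : v a - w a = x a - (z a)%:~R by rewrite -xz /v; ring.
  by rewrite opprB addrA subrK yP.
have v0 : \sum_a v a = 0 by rewrite sumrB (sum_reflection o q_gt0 k) w'0 subrr.
have vw0 a : `|v a - w a - (u a)%:~R| <= d.
  have dnd : d / n <= d by rewrite ler_pdivrMr// ler_peMr// ltW.
  have [->{a}|ak] := eqVneq a k; last by apply/ltW/(lt_le_trans (vw a ak)).
  have -> : v k - w k - (u k)%:~R = - \sum_(a | a != k) (v a - w a - (u a)%:~R).
    have : \sum_a (v a - w a - (u a)%:~R) = 0.
      rewrite 2!sumrB v0 w0 subrr sub0r -raddf_sum (bigD1 k)//= /u eqxx.
      rewrite [X in - X](_ : _ = 0) ?oppr0//.
      rewrite [X in _ + X](eq_bigr (fun a => y a - z a)) ?addNr//.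
      by move=> a /negPf->.
    by rewrite (bigD1 k)//= => /eqP; rewrite addr_eq0 => /eqP.
  rewrite normrN (le_trans (ler_norm_sum _ _ _))//.
  apply: (@le_trans _ _ (\sum_(a : I) d / n)).
    rewrite [leRHS](bigID (fun a => a != k))/= -[leLHS]addr0 lerD//.
      by apply: ler_sum => a /vw/ltW.
    by rewrite sumr_ge0// => a _; exact: ltW.
  by rewrite sumr_const -mulr_natr divfK// gt_eqF.
have sv : in_strip q o v := reflect_in_strip sw'.
have ww : \sum_a w a = \sum_a v a by rewrite w0 v0.
have [u0|[a [b [ab tie]]]] := in_strip_rigid q_gt0 sw sv ww vw0 dn.
  right; have := vw0 k; rewrite u0 subr0 /v distrC opprB addrA => wk.
  exact: le_trans wk dE.
left; apply/existsP; exists a; apply/existsP; exists b.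
by rewrite ab (le_trans tie).
Qed.

Lemma kernel_row (k : I) (L : nat) (s : seq I) : (0 < L)%N ->
  uniq s -> k \notin s -> exists C : R, forall (tau : I -> R) (N X : nat),
    `|\sum_(M < X)
        \prod_(a <- s) fejer L (2 * pi * ((N + M)%:R * p a + tau a))
      - X%:R| <= C.
Proof.
move=> L_gt0 us ks.
have indep (c : I -> int) (z : int) : c k = 0 ->
    \sum_a (c a)%:~R * p a = z%:~R -> forall a, c a = 0.
  by move=> ck /p_indep cz a; rewrite cz -(cz k).
have [C HC] := fejer_mean indep L_gt0 us ks.
exists C => tau N X.
have := HC (fun a => 2 * pi * (N%:R * p a + tau a)) X.
under [X in X - _]eq_bigr => M _.
  under eq_bigr => a _.
    have -> : M%:R * (2 * pi * p a) + 2 * pi * (N%:R * p a + tau a) =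
      2 * pi * ((N + M)%:R * p a + tau a) by rewrite natrD; ring.
    over.
  over.
by [].
Qed.


(* The double sum of [kernel (N + M) * (w N k + w M k - reflection k)] is
   computed twice.  The kernel has mean 1 in each variable, so it is about
   [X * \sum_N (2 * w N k - reflection k)]; the kernel concentrates where
   [- (N + M) p] is close to the reflection centre modulo 1, where the summand
   is small unless [w N] is near a tie. *)
Lemma reflection_mean (N1 : nat) (k : I) (e : R) : 0 < e ->
  exists X0 : nat, forall (X : nat) (s : nat -> I -> int)
    (w := fun N a => (s N a)%:~R - (N + N1)%:R * p a),
    (X0 <= X)%N -> (forall N, in_strip q o (w N)) ->
    (forall N, \sum_a w N a = 0) ->
    `|\sum_(N < X) w N k - X%:R * (reflection q o k / 2)| <= e * X%:R.
Proof.
move=> e_gt0; have [B HB] := in_strip_bounded o q_gt0.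
set r := reflection q o k; pose B' := 2 * `|B| + `|r|.
have B'0 : 0 <= B' by rewrite addr_ge0// mulr_ge0.
(* The final errors are [B' * e1] from the row sums and [2 * (2 * B' + 1) * e1] from the double
   sum. *)
pose e1 := e / (5 * B' + 2).
have e10 : 0 < e1 by rewrite divr_gt0//; lra.
have e1E : e1 * (5 * B' + 2) = e by rewrite divfK// gt_eqF//; lra.
clearbody e1.
have [eta eta0 [X1 tieX]] := near_tie_sparse B e10.
have [eta1 eta10 close] := reflection_close k e10 eta0.
pose n : R := #|I|%:R.
(* A kernel factor is at most [rho] where its sine is at least [eta1]; [L] makes [n * rho] at most
   [e1]. *)
pose L := (Num.bound (2 * n / (e1 * eta1 ^+ 2))).+1.
pose rho : R := 2 / (L%:R * eta1 ^+ 2).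
have rho0 : 0 <= rho by rewrite divr_ge0// mulr_ge0// exprn_ge0// ltW.
have rhoE : n * rho <= e1.
  rewrite /rho mulrA ler_pdivrMr ?mulr_gt0// ?exprn_gt0//.
  rewrite mulrCA mulrC -ler_pdivrMr ?mulr_gt0// ?exprn_gt0//.
  apply: (@le_trans _ _ (Num.bound (2 * n / (e1 * eta1 ^+ 2)))%:R).
    by rewrite ltW// archi_boundP// divr_ge0 ?mulr_ge0// ?exprn_ge0 ?ltW.
  by rewrite ler_nat.
pose t := [seq a <- enum I | a != k].
have ut : uniq t by rewrite filter_uniq// enum_uniq.
have kt : k \notin t by rewrite mem_filter eqxx.
have [C0 HC0] := kernel_row (ltn0Sn _ : (0 < L)%N) ut kt.
have /choice[Ca HCa] : forall a, exists C : R,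
    forall (tau : I -> R) (N X : nat),
    `|\sum_(M < X) \prod_(b <- rem a t)
        fejer L (2 * pi * ((N + M)%:R * p b + tau b)) - X%:R| <= C.
  move=> a; apply: (@kernel_row k) => //; first exact: rem_uniq.
  by apply: contra kt; apply: mem_rem.
pose C := `|C0| + \sum_a `|Ca a|.
have C00 : C0 <= C by rewrite (le_trans (ler_norm _))// lerDl sumr_ge0.
have Ca0 a : Ca a <= C.
  rewrite (le_trans (ler_norm _))// /C (bigD1 a)//=.
  by rewrite addrCA lerDl addr_ge0// sumr_ge0.
have C_ge0 : 0 <= C by rewrite addr_ge0// sumr_ge0.
exists (maxn X1 (maxn (Num.bound (C / e1)) (Num.bound C))) => X s w.
rewrite !geq_max => /and3P[XX1 XC1 XC] strip_w w0.
have CX : C <= X%:R.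
  by rewrite (le_trans (ltW (archi_boundP _)))// ler_nat.
have CeX : C <= e1 * X%:R.
  rewrite -ler_pdivrMl// mulrC (le_trans (ltW (archi_boundP _))) ?ler_nat//.
  by rewrite divr_ge0// ltW.
have wB N a : `|w N a| <= B by exact: HB.
have ties := tieX X N1 s XX1 wB.
(* Both house sizes are shifted by [N1], hence [2 * N1]; [x N M] is then [reflection - w N - w M]
   modulo 1. *)
pose tau a := 2 * N1%:R * p a + reflection q o a.
pose x (N M : nat) a := (N + M)%:R * p a + tau a.
pose ker (u : seq I) (N M : nat) := \prod_(a <- u) fejer L (2 * pi * x N M a).
have ker0 u N M : 0 <= ker u N M by apply: prodr_ge0 => a _; exact: fejer_ge0.
have kerC u N M : ker u N M = ker u M N by rewrite /ker /x addnC.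
pose S N := \sum_(M < X) ker t N M.
have SX N : `|S N - X%:R| <= C by exact: le_trans (HC0 tau N X) C00.
have SaX a N : \sum_(M < X) ker (rem a t) N M <= X%:R + C.
  have := le_trans (HCa a tau N X) (Ca0 a).
  by rewrite ler_norml => /andP[_]; rewrite lerBlDl.
have wB' N M : `|w N k + w M k - r| <= B'.
  rewrite (le_trans (ler_normB _ _))// lerD2r (le_trans (ler_normD _ _))//.
  rewrite mulr2n mulrDl mul1r.
  by rewrite lerD// (le_trans (wB _ _))// ler_norm.
(* Either all coordinates in [t] are near integers and [reflection_close] applies, or some [a] is
   far: its factor is at most [rho], and the remaining factors, over [rem a t], still have bounded
   row means. *)
have pointwise N M : `|w N k + w M k - r| * ker t N M <=
    (e1 + B' * (near_tie eta (w N))%:R) * ker t N M +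
    B' * rho * \sum_(a : I) ker (rem a t) N M.
  have [/allP far|/allPn[a at_ far]] :=
      boolP (all (fun a => `|sin (pi * x N M a)| < eta1) t).
    have hI (a : I) : exists z : int,
        reflection q o a - w N a - w M a = x N M a - z%:~R.
      exists (s N a + s M a).
      by rewrite /x /tau /w intrD !natrD; ring.
    apply: ler_wpDr.
      by apply: mulr_ge0; [exact: mulr_ge0|exact: sumr_ge0].
    apply: ler_wpM2r => //.
    have far' a : a != k -> `|sin (pi * x N M a)| < eta1.
      by move=> ak; apply: far; rewrite mem_filter ak mem_enum.
    have [->|le1] := close _ _ _ (strip_w N) (strip_w M) (w0 N) (w0 M) hI far'.
      by rewrite mulr1 (le_trans (wB' _ _))// lerDr ltW.
    by rewrite (le_trans le1)// lerDl mulr_ge0.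
  apply: ler_wpDl.
    by rewrite mulr_ge0// addr_ge0 ?mulr_ge0// ltW.
  rewrite -mulrA; apply: ler_pM => //.
  apply: (@le_trans _ _ (rho * ker (rem a t) N M)); last first.
    by rewrite ler_wpM2l// (bigD1 a)//= lerDl sumr_ge0.
  rewrite /ker (perm_big _ (perm_to_rem at_))/= big_cons ler_wpM2r ?ker0//.
  have := fejer_le L (2 * pi * x N M a).
  have -> : 2 * pi * x N M a / 2 = pi * x N M a by field.
  move=> fle; rewrite /rho invfM mulrA ler_pdivlMr ?exprn_gt0//.
  apply: le_trans fle; rewrite mulrC ler_wpM2r ?fejer_ge0//.
  rewrite -[leRHS]real_normK ?num_real//.
  by rewrite lerXn2r ?nnegrE ?(ltW eta10)// leNgt.
pose T := \sum_(N < X) (near_tie eta (w N))%:R : R.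
have T_le : T <= e1 * X%:R by rewrite /T -natr_sum.
have T_ge0 : 0 <= T by rewrite sumr_ge0.
have dsum : `|\sum_(N < X) \sum_(M < X) (w N k + w M k - r) * ker t N M| <=
    (e1 * X%:R + B' * T + B' * (n * rho) * X%:R) * (X%:R + C).
  apply: (@le_trans _ _ (\sum_(N < X)
      ((e1 + B' * (near_tie eta (w N))%:R) * (X%:R + C)
      + B' * rho * (n * (X%:R + C))))).
    rewrite (le_trans (ler_norm_sum _ _ _))//; apply: ler_sum => N _.
    rewrite (le_trans (ler_norm_sum _ _ _))//.
    apply: (@le_trans _ _ (\sum_(M < X)
        ((e1 + B' * (near_tie eta (w N))%:R) * ker t N M +
        B' * rho * \sum_(a : I) ker (rem a t) N M))).
      by apply: ler_sum => M _; rewrite normrM (ger0_norm (ker0 _ _ _)).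
    rewrite big_split/= -!mulr_sumr lerD//.
      rewrite ler_wpM2l ?addr_ge0 ?mulr_ge0 ?(ltW e10)//.
      by have := SX N; rewrite ler_norml => /andP[_]; rewrite lerBlDl.
    rewrite ler_wpM2l ?(mulr_ge0 B'0 rho0)// exchange_big/=.
    rewrite mulr_natl -sumr_const.
    by apply: ler_sum => a _; exact: SaX.
  rewrite big_split/= -mulr_suml big_split/= -mulr_sumr -/T.
  rewrite !sumr_const !card_ord.
  rewrite -[e1 *+ X]mulr_natr -[(B' * _ * _) *+ X]mulr_natr.
  by rewrite le_eqVlt; apply/orP; left; apply/eqP; ring.
have dsumE : \sum_(N < X) \sum_(M < X) (w N k + w M k - r) * ker t N M =
    \sum_(N < X) (2 * w N k - r) * S N.
  (* The kernel depends only on [N + M], so the two deviations play symmetric parts. *)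
  have wS : \sum_(N < X) \sum_(M < X) w M k * ker t N M =
      \sum_(N < X) w N k * S N.
    rewrite exchange_big; apply: eq_bigr => N _; rewrite /S mulr_sumr.
    by apply: eq_bigr => M _; rewrite kerC.
  transitivity (\sum_(N < X) ((w N k - r) * S N) + \sum_(N < X) w N k * S N).
    rewrite -wS -big_split; apply: eq_bigr => N _ /=.
    rewrite mulr_sumr -big_split; apply: eq_bigr => M _ /=; ring.
  by rewrite -big_split; apply: eq_bigr => N _ /=; ring.
pose D := \sum_(N < X) (2 * w N k - r).
have DX : `|D * X%:R| <= X%:R * (B' * C) +
    (e1 * X%:R + B' * T + B' * (n * rho) * X%:R) * (X%:R + C).
  have -> : D * X%:R = \sum_(N < X) (2 * w N k - r) * (X%:R - S N) +
      \sum_(N < X) \sum_(M < X) (w N k + w M k - r) * ker t N M.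
    by rewrite dsumE -big_split /D mulr_suml; apply: eq_bigr => N _ /=; ring.
  rewrite (le_trans (ler_normD _ _))// lerD//.
  rewrite (le_trans (ler_norm_sum _ _ _))//.
  apply: (@le_trans _ _ (\sum_(N < X) B' * C)); last first.
    by rewrite sumr_const card_ord mulr_natl.
  apply: ler_sum => N _; rewrite normrM ler_pM//.
    by have := wB' N N; congr (`|_| <= _); ring.
  by rewrite distrC.
have [X0|X0] := posnP X.
  by rewrite X0 big_ord0 !mul0r mulr0 subrr normr0.
have XR : 0 < X%:R :> R by rewrite ltr0n.
have DE : D = 2 * (\sum_(N < X) w N k - X%:R * (r / 2)).
  by rewrite /D sumrB -mulr_sumr sumr_const card_ord -[r *+ X]mulr_natl; field.
have {}DX : `|D| * X%:R <= (e1 * (5 * B' + 2) * X%:R) * X%:R.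
  have -> : `|D| * X%:R = `|D * X%:R| by rewrite normrM (ger0_norm (ltW XR)).
  rewrite (le_trans DX)//.
  have X_ge0 := ltW XR.
  have h1 : X%:R * (B' * C) <= B' * e1 * X%:R * X%:R.
    have := ler_wpM2l (mulr_ge0 X_ge0 B'0) CeX; clear; lra.
  have h2 : e1 * X%:R + B' * T + B' * (n * rho) * X%:R <=
      e1 * (2 * B' + 1) * X%:R.
    have a1 : B' * T <= B' * (e1 * X%:R) by rewrite ler_wpM2l.
    have a2 : B' * (n * rho) * X%:R <= B' * e1 * X%:R.
      by rewrite ler_wpM2r// ler_wpM2l.
    clear -a1 a2; lra.
  have h3 : X%:R + C <= 2 * X%:R by rewrite mulr2n mulrDl mul1r lerD2l.
  have h4 : 0 <= e1 * X%:R + B' * T + B' * (n * rho) * X%:R.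
    have nrho : 0 <= n * rho := mulr_ge0 (ler0n _ _) rho0.
    by rewrite !addr_ge0 ?(mulr_ge0 (ltW e10))// mulr_ge0// mulr_ge0.
  have h5 := ler_pM h4 (addr_ge0 X_ge0 C_ge0) h2 h3.
  apply: le_trans (lerD h1 h5) _.
  rewrite le_eqVlt; apply/orP; left; apply/eqP; ring.
move: DX; rewrite ler_pM2r// e1E.
rewrite DE normrM gtr0_norm//; set y := `|_|.
have := mulr_ge0 (ltW e_gt0) (ltW XR); set u := e * X%:R; clearbody u y; lra.
Qed.

End Reflection.

(** ** Election methods *)

Section Seats.
Context {R : realType} (I : finType) (p : I -> R).
Hypothesis p_gt0 : forall k, 0 < p k.
Hypothesis p_sum1 : \sum_k p k = 1.
Hypothesis p_indep : lin_indep_rat p.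

Lemma lin_indep_int (c : I -> int) (z : int) :
  \sum_a (c a)%:~R * p a = z%:~R -> forall a, c a = z.
Proof.
move=> cz a.
have : ((c a - z)%:~R : rat) = 0.
  apply: (p_indep (c := fun a => (c a - z)%:~R)).
  under eq_bigr do rewrite ratr_int intrD mulrNz mulrBl.
  by rewrite sumrB -mulr_sumr p_sum1 mulr1 cz subrr.
by move/eqP; rewrite intr_eq0 subr_eq0 => /eqP.
Qed.

(** The products [h * p a * p b] cancel, leaving the rational relation [y * p b = z * p a]. *)
Lemma no_ties_divisor (a b : I) (y z : int) (h : nat) : a != b -> (0 < h)%N ->
  p b * (y%:~R - h%:R * p a) = p a * (z%:~R - h%:R * p b) -> y = 0.
Proof.
move=> ab _ tie.
pose c k : int := if k == b then y else if k == a then - z else 0.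
have /lin_indep_int/(_ b) : \sum_k (c k)%:~R * p k = (0 : int)%:~R.
  rewrite (bigD1 b)//= (bigD1 a)//= big1 => [|k /andP[/negPf kb /negPf ka]].
    by rewrite /c eqxx (negPf ab) eqxx mulrNz; lra.
  by rewrite /c kb ka mul0r.
by rewrite /c eqxx.
Qed.

(** The equation is contradictory: it makes [h * (p a - p b)] an integer, so the coefficients [h]
    and [- h] would be equal. *)
Lemma no_ties_quota (a b : I) (y z : int) (h : nat) : a != b -> (0 < h)%N ->
  1 * (y%:~R - h%:R * p a) = 1 * (z%:~R - h%:R * p b) -> y = 0.
Proof.
move=> ab h0 tie.
pose c k : int := if k == b then - h%:Z else if k == a then h%:Z else 0.
have /lin_indep_int cE : \sum_k (c k)%:~R * p k = (y - z)%:~R.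
  rewrite (bigD1 b)//= (bigD1 a)//= big1 => [|k /andP[/negPf kb /negPf ka]].
    by rewrite /c eqxx (negPf ab) eqxx intrD !mulrNz; lra.
  by rewrite /c kb ka mul0r.
have := cE b; have := cE a; rewrite /c !eqxx (negPf ab); lia.
Qed.

Lemma quota_in_strip (gamma : R) (N : nat) (s : I -> int) :
  quota gamma p N s ->
  in_strip (fun=> 1) (fun k => gamma * p k) (fun k => (s k)%:~R - N%:R * p k) /\
  \sum_k s k = N%:Z.
Proof.
move=> [_ [al [sal sN]]]; split=> //; exists (- al) => k.
by have /andP[? ?] := sal k; apply/andP; split; lra.
Qed.

(** Large [N] forces [D^-1] to be large, since rounding adds at most [|beta| + 1] per party. Then
    every [p k / D] exceeds [beta], the maximum with 0 is inactive, and [T = D^-1 - N]. *)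
Lemma divisor_in_strip (beta : R) : \forall N \near \oo,
  forall s : I -> int, linear_divisor beta p N s ->
  in_strip p (fun=> - beta) (fun k => (s k)%:~R - N%:R * p k) /\
  \sum_k s k = N%:Z.
Proof.
pose n : R := #|I|%:R.
pose Y := n * (`|beta| + 1) + \sum_k `|beta| / p k.
have Y0 : 0 <= Y.
  rewrite addr_ge0 ?mulr_ge0 ?addr_ge0// sumr_ge0// => k _.
  by rewrite divr_ge0// ltW.
exists (Num.bound Y) => // N /= HN s [D D0 [r [rr sr sN]]]; split => //.
have YN : Y <= N%:R by rewrite (le_trans (ltW (archi_boundP Y0)))// ler_nat.
have tau : N%:R <= D^-1 + n * (`|beta| + 1).
  have -> : N%:R = \sum_k (s k)%:~R :> R.
    by rewrite -[LHS]/(N%:Z%:~R) -sN raddf_sum.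
  rewrite -[D^-1]mul1r -[X in X / D]p_sum1 mulr_suml mulr_natl -sumr_const.
  rewrite -big_split/=.
  apply: ler_sum => k _; rewrite sr.
  have := ler_norm (- beta); rewrite normrN => nb.
  have /andP[_ rk] := rr k.
  have pD : 0 < p k / D by rewrite divr_gt0.
  have := normr_ge0 beta.
  by rewrite /Num.max; case: ifP => _; [rewrite mulr0z|]; lra.
have rs k : s k = r k.
  rewrite sr max_l// -(ler_int R) mulr0z.
  have /andP[rk _] := rr k; apply: le_trans rk; rewrite subr_ge0.
  rewrite (le_trans (ler_norm _))// mulrC -ler_pdivrMr//.
  have : `|beta| / p k <= \sum_k `|beta| / p k.
    rewrite (bigD1 k)//= lerDl sumr_ge0// => a _.
    by rewrite divr_ge0// ltW.
  by move: YN; rewrite /Y; lra.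
exists (D^-1 - N%:R) => k; rewrite rs.
by have /andP[? ?] := rr k; apply/andP; split; lra.
Qed.

Lemma reflection_divisor (beta : R) (k : I) :
  reflection p (fun=> - beta) k / 2 = (beta - 2^-1) * (#|I|%:R * p k - 1).
Proof.
by rewrite /reflection p_sum1 sumr_const -[- beta *+ _]mulr_natl; field.
Qed.

Lemma reflection_quota (gamma : R) (k : I) :
  reflection (fun=> 1) (fun k => gamma * p k) k / 2 =
  gamma * (p k - #|I|%:R^-1).
Proof.
have n0 : #|I|%:R != 0 :> R.
  by rewrite pnatr_eq0 -lt0n; apply/card_gt0P; exists k.
by rewrite /reflection -mulr_sumr p_sum1 sumr_const; field.
Qed.

End Seats.

(** * From seat biases to the mean gain *)

(* Uniformity in the sample point allows the bound to be integrated. *)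
Definition uniform_bias (R : realType) (Omega : Type) (I : finType) (p : I -> R)
    (s : nat -> Omega -> I -> int) (c : I -> R) : Prop :=
  \forall N1 \near \oo, forall (k : I) (e : R), 0 < e -> \forall X \near \oo,
  forall w, `|\sum_(N < X) ((s (N + N1)%N w k)%:~R - (N + N1)%:R * p k) -
    X%:R * c k| <= e * X%:R.

Lemma strip_uniform_bias (R : realType) (Omega : Type) (I : finType)
    (p q o : I -> R) (s : nat -> Omega -> I -> int) :
  (forall k, 0 < p k) -> \sum_k p k = 1 -> lin_indep_rat p ->
  (forall k, 0 < q k) ->
  (forall a b (y z : int) (h : nat), a != b -> (0 < h)%N ->
    q b * (y%:~R - h%:R * p a) = q a * (z%:~R - h%:R * p b) -> y = 0) ->
  (\forall N \near \oo, forall w,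
    in_strip q o (fun k => (s N w k)%:~R - N%:R * p k) /\
    \sum_k s N w k = N%:Z) ->
  uniform_bias p s (fun k => reflection q o k / 2).
Proof.
move=> p0 p1 pI q0 ties [N0 _ HN0]; exists N0 => // N1 /= N01 k e e0.
have [X0 HX0] := reflection_mean o p0 p1 (lin_indep_int p1 pI) q0 ties N1 k e0.
exists X0 => // X /= XX0 w.
have NN N : (N0 <= N + N1)%N by rewrite (leq_trans N01)// leq_addl.
apply: (HX0 X (fun N => s (N + N1)%N w)) => // N.
  by have [] := HN0 _ (NN N) w.
have [_ sN] := HN0 _ (NN N) w.
rewrite sumrB -mulr_sumr p1 mulr1.
have -> : \sum_a (s (N + N1)%N w a)%:~R = (\sum_a s (N + N1)%N w a)%:~R :> R.
  by rewrite raddf_sum.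
by rewrite sN subrr.
Qed.

Lemma cesaro_expectation (R : realType) (d : measure_display)
    (Omega : measurableType d) (P : probability Omega R)
    (G : nat -> Omega -> R) (c : R) (N1 : nat) :
  (forall N, P.-integrable setT (EFin \o G N)) ->
  (forall e, 0 < e -> \forall X \near \oo, forall w,
    `|\sum_(N < X) G (N + N1)%N w - X%:R * c| <= e * X%:R) ->
  ((N0%:R^-1)%:E * \sum_(1 <= N < N0.+1) 'E_P[G N])%E @[N0 --> \oo] --> c%:E.
Proof.
move=> intG boundG.
pose E N := fine ('E_P[G N])%E.
have EE N : ('E_P[G N] = (E N)%:E)%E.
  rewrite /E fineK// unlock; apply: integrable_fin_num => //; exact: intG.
have meanE N0 : ((N0%:R^-1)%:E * \sum_(1 <= N < N0.+1) 'E_P[G N])%E =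
    (N0%:R^-1 * \sum_(1 <= N < N0.+1) E N)%:E.
  by under eq_bigr do rewrite EE; rewrite sumEFin.
under eq_fun do rewrite meanE.
apply: cvg_EFin; first by near=> N0.
apply/cvgrPdist_le => /= e e0.
have e20 : 0 < e / 2 by rewrite divr_gt0.
have [X0 _ HX0] := boundG _ e20.
have boundE X : (X0 <= X)%N ->
    `|\sum_(N < X) E (N + N1)%N - X%:R * c| <= e / 2 * X%:R.
  move=> XX0; have {}HX0 := HX0 X XX0.
  have SE : (\int[P]_w (\sum_(N < X) G (N + N1)%N w)%:E =
      (\sum_(N < X) E (N + N1)%N)%:E)%E.
    under eq_integral do rewrite -sumEFin.
    rewrite integral_sum//; last by move=> N; exact: intG.
    rewrite -sumEFin; apply: eq_bigr => N _.
    by rewrite -EE unlock.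
  have intS : P.-integrable setT (fun w => (\sum_(N < X) G (N + N1)%N w)%:E).
    under eq_fun do rewrite -sumEFin.
    by apply: integrable_sum => // N _; exact: intG.
  have intc (r : R) : P.-integrable setT (fun=> r%:E).
    exact: finite_measure_integrable_cst.
  have intcE (r : R) : (\int[P]_w r%:E = r%:E)%E.
    by rewrite integral_cst//= probability_setT mule1.
  rewrite ler_distl; apply/andP; split; rewrite -lee_fin -SE.
    rewrite -[leLHS]intcE; apply: le_integral => // w _.
    by rewrite lee_fin; have := HX0 w; rewrite ler_distl => /andP[].
  rewrite -[leRHS]intcE; apply: le_integral => // w _.
  by rewrite lee_fin; have := HX0 w; rewrite ler_distl => /andP[].
(* The terms outside the shifted sum, which starts at [N1]. Subtracting [E 0] accounts for the mean
   starting at 1, even when [N1 = 0]. *)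
pose A0 := \sum_(0 <= N < N1) E N - E 0%N.
pose A : R := `|A0| + e / 2 + `|c| * N1.+1%:R.
exists (maxn (N1 + X0) (Num.bound (A / (e / 2)))).+1 => // N0 /=.
rewrite gtn_max => /andP[N0X N0A].
have N0_gt0 : 0 < N0%:R :> R by rewrite ltr0n; lia.
pose X := (N0.+1 - N1)%N.
have -> : \sum_(1 <= N < N0.+1) E N = A0 + \sum_(N < X) E (N + N1)%N.
  rewrite -(big_mkord xpredT (fun N => E (N + N1)%N)) /A0 addrAC.
  rewrite /X -(big_addn 0 N0.+1 N1 xpredT E) add0n -big_cat_nat//; last by lia.
  by rewrite big_nat_recl// addrAC subrr add0r big_add1.
set S := \sum_(_ < X) _; have SX : `|S - X%:R * c| <= e / 2 * X%:R.
  by apply: boundE; rewrite /X; lia.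
have XR : X%:R = N0%:R + 1 - N1%:R :> R.
  by rewrite natrB ?natr1//; lia.
have -> : c - N0%:R^-1 * (A0 + S) = N0%:R^-1 * (N0%:R * c - (A0 + S)).
  by field; rewrite gt_eqF.
rewrite normrM gtr0_norm ?invr_gt0// mulrC ler_pdivrMr//.
have -> : N0%:R * c - (A0 + S) = - A0 - (S - X%:R * c) - c * (1 - N1%:R).
  by rewrite XR; ring.
have AN : A <= e / 2 * N0%:R.
  rewrite -ler_pdivrMl// mulrC (@le_trans _ _ (Num.bound (A / (e / 2)))%:R)//.
    by rewrite ltW// archi_boundP// divr_ge0 ?addr_ge0 ?mulr_ge0// ?ltW.
  by rewrite ler_nat ltnW.
rewrite (le_trans (ler_normB _ _))//.
have c1 : `|c * (1 - N1%:R)| <= `|c| * N1.+1%:R.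
  rewrite normrM ler_wpM2l// (le_trans (ler_normB _ _))//.
  by rewrite normr1 normr_nat -nat1r.
have := ler_normB (- A0) (S - X%:R * c); rewrite normrN.
have XN : e / 2 * X%:R <= e / 2 * (N0%:R + 1).
  by rewrite ler_wpM2l ?(ltW e20)// XR; have := ler0n R N1; lra.
by move: AN c1 SX XN; rewrite /A; lra.
Unshelve. all: by end_near.
Qed.

Section Merged.
Context {R : realType} (I : finType) (i j : I).
Hypothesis ij : i != j.

Lemma sum_merged (f : merged i j -> R) (g : I -> R) :
  f None = g i + g j -> (forall k, f (Some k) = g (val k)) ->
  \sum_k f k = \sum_k g k.
Proof.
move=> fN fS; rewrite (bigD1 None)//= fN.
rewrite [RHS](bigD1 i)//= (bigD1 j)/= 1?eq_sym// addrA; congr (_ + _).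
rewrite (reindex_omap Some id)/=; last by case.
rewrite [RHS](reindex_omap (val : {k : I | (k != i) && (k != j)} -> I) insub)/=;
  last by move=> k kij; rewrite insubT.
by apply: eq_big => [k|k _]; rewrite ?fS// valK (valP k) !eqxx.
Qed.

Lemma card_merged : #|merged i j|%:R = #|I|%:R - 1 :> R.
Proof.
have := @sum_merged (fun k => if k is None then 2 else 1) (fun=> 1)
  erefl (fun=> erefl).
rewrite sumr_const => <-; rewrite (bigD1 None)//= addrAC addrK.
rewrite -[LHS](sumr_const (merged i j)) (bigD1 None)//=.
by congr (_ + _); apply: eq_bigr; case.
Qed.

Variable p : I -> R.

Lemma merged_votes_gt0 : (forall k, 0 < p k) ->
  forall k, 0 < @merged_votes R I i j p k.
Proof. by move=> p_gt0 [k|] /=; rewrite ?addr_gt0. Qed.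

Lemma sum_merged_votes : \sum_(k : merged i j) merged_votes p k = \sum_k p k.
Proof. exact: sum_merged. Qed.

(** A relation among the merged votes is one among the original votes in which [i] and [j] share the
    coefficient of [None]. *)
Lemma merged_votes_indep : lin_indep_rat p ->
  lin_indep_rat (@merged_votes R I i j p).
Proof.
move=> pI c c0.
pose c' k : rat := if insub k is Some k' then c (Some k') else c None.
have c'N k : k \in [:: i; j] -> c' k = c None.
  by rewrite /c' !inE; case: insubP => // u /andP[/negPf-> /negPf->].
have {}c0 : \sum_k ratr (c' k) * p k = 0.
  apply: etrans c0; apply: esym; apply: sum_merged.
    by rewrite !c'N ?inE ?eqxx ?orbT//= mulrDr.
  by move=> k; rewrite /c' valK.
case=> [k|]; first by have := pI _ c0 (val k); rewrite /c' valK.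
by have := pI _ c0 i; rewrite c'N// mem_head.
Qed.

End Merged.

Lemma mean_gain_cvg (R : realType) (I : finType) (i j : I)
    (p : I -> R) (d : measure_display) (Omega : measurableType d)
    (P : probability Omega R)
    (s : nat -> Omega -> I -> int) (t : nat -> Omega -> merged i j -> int)
    (c : I -> R) (c' : merged i j -> R) :
  (forall N k, P.-integrable setT (fun w => ((s N w k)%:~R : R)%:E)) ->
  (forall N k, P.-integrable setT (fun w => ((t N w k)%:~R : R)%:E)) ->
  uniform_bias p s c -> uniform_bias (merged_votes p) t c' ->
  mean_gain P s t N0 @[N0 --> \oo] --> (c' None - c i - c j)%:E.
Proof.
move=> ints intt [N1 _ biass] [N2 _ biast].
pose N3 := maxn N1 N2.
apply: (@cesaro_expectation _ _ _ _ _ _ N3).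
  move=> N; rewrite [X in P.-integrable _ X](_ : _ = (fun w =>
      ((t N w None)%:~R : R)%:E - ((s N w i)%:~R : R)%:E
      - ((s N w j)%:~R : R)%:E)%E).
    by apply: integrableB => //; apply: integrableB.
  by apply/funext => w /=; rewrite /seat_gain !intrD !mulrNz !EFinB.
move=> e e0; have e30 : 0 < e / 3 by rewrite divr_gt0.
have [X1 _ HX1] := biass N3 (leq_maxl _ _) i _ e30.
have [X2 _ HX2] := biass N3 (leq_maxl _ _) j _ e30.
have [X3 _ HX3] := biast N3 (leq_maxr _ _) None _ e30.
exists (maxn X1 (maxn X2 X3)) => // X /=.
rewrite !geq_max => /and3P[/HX1 h1 /HX2 h2 /HX3 h3] w.
have := h1 w; have := h2 w; have := h3 w.
set S1 := \sum_(_ < X) _; set S2 := \sum_(_ < X) _; set S3 := \sum_(_ < X) _.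
have -> : \sum_(N < X) seat_gain R s t (N + N3) w = S1 - S2 - S3.
  rewrite /S1 /S2 /S3 -!sumrB; apply: eq_bigr => N _.
  by rewrite /seat_gain !intrD !mulrNz /=; ring.
rewrite !ler_norml => /andP[? ?] /andP[? ?] /andP[? ?].
by apply/andP; split; lra.
Qed.

Theorem theorem8p1 (R : realType) (m : nat) (hm : (2 <= m)%N)
    (p : 'I_m -> R) (p_gt0 : forall k, 0 < p k) (p_sum1 : \sum_k p k = 1)
    (p_indep : lin_indep_rat p) (i j : 'I_m) (ij : i != j)
    (d : measure_display) (Omega : measurableType d) (P : probability Omega R)
    (s : nat -> Omega -> 'I_m -> int) (t : nat -> Omega -> merged i j -> int) :
  (forall beta : R,
     seats_by (linear_divisor beta) P p s ->
     seats_by (linear_divisor beta) P (merged_votes p) t ->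
     mean_gain P s t N0 @[N0 --> \oo] -->
       ((beta - 2^-1) * (1 - p i - p j))%:E) /\
  (forall gamma : R,
     seats_by (quota gamma) P p s ->
     seats_by (quota gamma) P (merged_votes p) t ->
     mean_gain P s t N0 @[N0 --> \oo] -->
       (gamma * (2 / m%:R - 1 / (m%:R - 1)))%:E /\
     gamma * (2 / m%:R - 1 / (m%:R - 1)) =
       gamma * ((m%:R - 2) / (m%:R * (m%:R - 1)))).
Proof.
pose p' : merged i j -> R := merged_votes p.
have p'_gt0 : forall k, 0 < p' k by exact: merged_votes_gt0.
have p'_sum1 : \sum_k p' k = 1 by rewrite sum_merged_votes.
have p'_indep : lin_indep_rat p' by exact: merged_votes_indep.
have cardm : #|'I_m|%:R = m%:R :> R by rewrite card_ord.
have cardm' : #|merged i j|%:R = m%:R - 1 :> R.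
  by rewrite card_merged// card_ord.
have m0 : m%:R != 0 :> R by rewrite pnatr_eq0; lia.
have m1 : m%:R - 1 != 0 :> R by rewrite subr_eq0 pnatr_eq1; lia.
split=> [beta [ints seatss] [intt seatst]|gamma [ints seatss] [intt seatst]].
  have bs : uniform_bias p s (fun k => reflection p (fun=> - beta) k / 2).
    apply: strip_uniform_bias => //; first exact: no_ties_divisor.
    have := divisor_in_strip p_gt0 p_sum1 beta.
    by apply: filterS2 seatss => N h1 h2 w; exact/h2/h1.
  have bt : uniform_bias p' t (fun k => reflection p' (fun=> - beta) k / 2).
    apply: strip_uniform_bias => //; first exact: no_ties_divisor.
    have := divisor_in_strip p'_gt0 p'_sum1 beta.
    by apply: filterS2 seatst => N h1 h2 w; exact/h2/h1.
  have := mean_gain_cvg ints intt bs bt; rewrite !reflection_divisor//.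
  by congr (_ --> _%:E); rewrite cardm cardm' /p'/=; field.
split; last by field; rewrite m0 m1.
have bs : uniform_bias p s
    (fun k => reflection (fun=> 1) (fun k => gamma * p k) k / 2).
  apply: strip_uniform_bias => //; first exact: no_ties_quota.
  by apply: filterS seatss => N h w; exact/quota_in_strip/h.
have bt : uniform_bias p' t
    (fun k => reflection (fun=> 1) (fun k => gamma * p' k) k / 2).
  apply: strip_uniform_bias => //; first exact: no_ties_quota.
  by apply: filterS seatst => N h w; exact/quota_in_strip/h.
have := mean_gain_cvg ints intt bs bt; rewrite !reflection_quota//.
by congr (_ --> _%:E); rewrite cardm cardm' /p'/=; field; rewrite m0 m1.
Qed.
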